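(* The structure $(\widetilde\omega,\widetilde T,\phi,g)$ on the Heisenberg group $\mathfrak{H}$ is Sasakian.
   Context: $\mathfrak{H}=\mathbb{C}\times\mathbb{R}$ is the Heisenberg group with coordinates $(z=x+iy,t)$ and multiplication $(z,t)*(w,s)=(z+w,t+s+2\Im(z\overline w))$. Put $X=\partial_x+2y\,\partial_t$, $Y=\partial_y-2x\,\partial_t$, $T=\partial_t$, $\omega=dt+2x\,dy-2y\,dx$; $\widetilde T=2T$, $\widetilde\omega=\tfrac12\omega$. The metric $g=dx^2+dy^2+\tfrac14\omega^2$ is the Riemannian metric for which $\{X,Y,\widetilde T\}$ is orthonormal. The endomorphism $\phi$ of $T(\mathfrak{H})$ is given by $\phi X=Y$, $\phi Y=-X$, $\phi\widetilde T=0$. Contact Riemannian structure: on a $(2p+1)$-dimensional manifold $M$ with contact form $\eta$ and Reeb vector field $\xi$ ($\eta(\xi)=1$, $\xi\in\ker d\eta$), a tuple $(M;\eta,\xi,\phi,g_M)$ with $\phi$ an endomorphism of $T(M)$ and $g_M$ a Riemannian metric such that $\eta(U)=g_M(U,\xi)$, $\tfrac12 d\eta(U,V)=g_M(\phi U,V)$, $\phi^2U=-U+\eta(U)\xi$ for all vector fields $U,V$. Convention: $(\alpha\wedge\beta)(U,V)=\alpha(U)\beta(V)-\alpha(V)\beta(U)$. Sasakian: a contact Riemannian manifold $(M;\eta,\xi,\phi,g_M)$ such that (1) $\xi$ is Killing for $g_M$; (2) $\xi$ is a unit vector field and $R(U,\xi)V=g_M(U,V)\xi-g_M(\xi,V)U$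 for all vector fields $U,V$, where $R(U,V)W=\nabla_V\nabla_UW-\nabla_U\nabla_VW+\nabla_{[U,V]}W$ and $\nabla$ is the Levi-Civita connection of $g_M$. *)

(* Defs.v *)
From HB Require Import structures.
From mathcomp Require Import all_boot all_order all_algebra all_fingroup.
From mathcomp Require Import all_classical all_reals all_analysis.
From mathcomp Require Import complex.
From mathcomp Require Import ring lra.

Set Implicit Arguments.
Unset Strict Implicit.
Unset Printing Implicit Defensive.

Import Order.TTheory GRing.Theory Num.Theory.
Import numFieldNormedType.Exports.

Local Open Scope ring_scope.

(* Differential geometry in a global chart: the manifold is R^n, its points are
   row vectors, and every tangent space is identified with R^n through the
   coordinate frame.  A tensor field is a function of a point and of tangent
   vectors at that point. *)
Section Geometry.
Context {R : realType} {n : nat}.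
Notation V := 'rV[R]_n.
Implicit Types (U W Z xi : V -> V) (p u v w : V).
Implicit Types (eta : V -> V -> R) (phi : V -> V -> V) (g : V -> V -> V -> R).

(* C^oo: all the iterated directional derivatives are (Frechet) differentiable. *)
Definition smooth (T : normedModType R) (f : V -> T) : Prop :=
  forall (s : seq V) p, differentiable (foldr (fun v h => 'D_v h) f s) p.

Definition vector_field U : Prop := smooth U.

(* The first component is linearity at each point; by linearity, smoothness
   need only be required on constant fields. *)
Definition one_form eta : Prop :=
  (forall p, scalar (eta p)) /\ (forall v, smooth (eta ^~ v)).

Definition endomorphism_field phi : Prop :=
  (forall p, linear (phi p)) /\ (forall v, smooth (phi ^~ v)).

Record riemannian_metric g : Prop := RiemannianMetric {
  metric_scalar : forall p u, scalar (g p u);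
  metric_sym : forall p u v, g p u v = g p v u;
  metric_pos : forall p u, u != 0 -> 0 < g p u u;
  metric_smooth : forall u v, smooth (fun p => g p u v)
}.

Definition lie U W : V -> V := fun p => 'D_(U p) W p - 'D_(W p) U p.

(* d eta = \sum_j (d eta_j) /\ dx_j, with
   (a /\ b)(u, v) = a u * b v - a v * b u. *)
Definition ext_d eta : V -> V -> V -> R :=
  fun p u v => 'D_u (eta ^~ v) p - 'D_v (eta ^~ u) p.

(* Killing: the Lie derivative of the metric along the field vanishes. *)
Definition lie_metric xi g U W : V -> R := fun p =>
  'D_(xi p) (fun q => g q (U q) (W q)) p
  - g p (lie xi U p) (W p) - g p (U p) (lie xi W p).

Definition killing g xi : Prop :=
  forall U W, vector_field U -> vector_field W ->
  forall p, lie_metric xi g U W p = 0.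

Record affine_connection (nabla : (V -> V) -> (V -> V) -> (V -> V)) : Prop :=
  AffineConnection {
  conn_field : forall U W, vector_field U -> vector_field W ->
    vector_field (nabla U W);
  conn_addl : forall U W Z,
    vector_field U -> vector_field W -> vector_field Z ->
    forall p, nabla (fun q => U q + W q) Z p = nabla U Z p + nabla W Z p;
  conn_scalel : forall (f : V -> R) U W,
    smooth f -> vector_field U -> vector_field W ->
    forall p, nabla (fun q => f q *: U q) W p = f p *: nabla U W p;
  conn_addr : forall U W Z,
    vector_field U -> vector_field W -> vector_field Z ->
    forall p, nabla U (fun q => W q + Z q) p = nabla U W p + nabla U Z p;
  conn_leibniz : forall (f : V -> R) U W,
    smooth f -> vector_field U -> vector_field W ->
    forall p, nabla U (fun q => f q *: W q) p
              = 'D_(U p) f p *: W p + f p *: nabla U W p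
}.

Record levi_civita g (nabla : (V -> V) -> (V -> V) -> (V -> V)) : Prop :=
  LeviCivita {
  lc_connection : affine_connection nabla;
  lc_torsion_free : forall U W, vector_field U -> vector_field W ->
    forall p, nabla U W p - nabla W U p = lie U W p;
  lc_metric : forall U W Z,
    vector_field U -> vector_field W -> vector_field Z ->
    forall p, 'D_(U p) (fun q => g q (W q) (Z q)) p
              = g p (nabla U W p) (Z p) + g p (W p) (nabla U Z p)
}.

(* Beware of the sign, opposite to the most common convention. *)
Definition curvature (nabla : (V -> V) -> (V -> V) -> (V -> V)) U W Z : V -> V :=
  fun p => nabla W (nabla U Z) p - nabla U (nabla W Z) p + nabla (lie U W) Z p.

Definition form k := ('I_k -> V) -> R.

Definition wedge k l (a : form k) (b : form l) : form (k + l) :=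
  fun v : 'I_(k + l) -> V =>
  (k`!%:R * l`!%:R)^-1 *
  \sum_(s : 'S_(k + l)) (-1) ^+ s * a (fun i => v (s (lshift l i)))
                                  * b (fun j => v (s (rshift k j))).

Fixpoint wedge_pow (b : form 2) (m : nat) : form m.*2 :=
  match m return form m.*2 with
  | 0 => fun=> 1
  | m'.+1 => wedge b (@wedge_pow b m')
  end.

Definition form1 (a : V -> R) : form 1 := fun v : 'I_1 -> V => a (v ord0).
Definition form2 (b : V -> V -> R) : form 2 :=
  fun v : 'I_2 -> V => b (v ord0) (v ord_max).

Lemma wedge11 (a b : V -> R) (v : 'I_2 -> V) :
  wedge (form1 a) (form1 b) v =
  a (v ord0) * b (v ord_max) - a (v ord_max) * b (v ord0).
Proof.
rewrite /wedge /form1 -[1`!]/1%N mulr1 invr1 mul1r.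
pose A : 'M[R]_2 := \matrix_(i, j) (if i == ord0 then a else b) (v j).
transitivity (\det A); last first.
  rewrite (expand_det_row _ ord0) big_ord_recl big_ord1 /cofactor !det_mx11 !mxE /=.
  rewrite expr0 mul1r expr1 mulN1r mulrN.
  by congr (a (v _) * b (v _) - a (v _) * b (v _)); apply: val_inj.
apply: eq_bigr => s _; rewrite -mulrA; congr (_ * _).
rewrite big_ord_recl big_ord1 !mxE /=.
by congr (a (v (s _)) * b (v (s _))); apply: val_inj.
Qed.

End Geometry.

Arguments wedge_pow {R n} b m.

Section Sasakian.
Context {R : realType} (m : nat).
Notation V := 'rV[R]_(m.*2.+1).
Implicit Types (eta : V -> V -> R) (xi : V -> V).
Implicit Types (phi : V -> V -> V) (g : V -> V -> V -> R).

(* eta /\ (d eta)^m vanishes nowhere. *)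
Definition contact_form eta : Prop :=
  one_form eta /\
  forall p, exists v : 'I_(1 + m.*2) -> V,
    wedge (form1 (eta p)) (wedge_pow (form2 (ext_d eta p)) m) v != 0.

Definition reeb_field eta xi : Prop :=
  [/\ vector_field xi, forall p, eta p (xi p) = 1
    & forall p v, ext_d eta p (xi p) v = 0].

Record contact_riemannian eta xi phi g : Prop := ContactRiemannian {
  cr_contact : contact_form eta;
  cr_reeb : reeb_field eta xi;
  cr_endo : endomorphism_field phi;
  cr_metric : riemannian_metric g;
  cr_dual : forall U, vector_field U ->
    forall p, eta p (U p) = g p (U p) (xi p);
  cr_d : forall U W, vector_field U -> vector_field W ->
    forall p, 2^-1 * ext_d eta p (U p) (W p) = g p (phi p (U p)) (W p);
  cr_phi2 : forall U, vector_field U ->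
    forall p, phi p (phi p (U p)) = - U p + eta p (U p) *: xi p
}.

(* The Levi-Civita connection is unique on smooth fields, so [exists] here
   means "the"; unlike [forall], it cannot hold vacuously. *)
Record sasakian eta xi phi g : Prop := Sasakian {
  sk_contact_riemannian : contact_riemannian eta xi phi g;
  sk_killing : killing g xi;
  sk_unit : forall p, g p (xi p) (xi p) = 1;
  sk_curvature : exists2 nabla, levi_civita g nabla &
    forall U W, vector_field U -> vector_field W ->
    forall p, curvature nabla U xi W p
              = g p (U p) (W p) *: xi p - g p (xi p) (W p) *: U p
}.

End Sasakian.

Section Heisenberg.
Context {R : realType}.

(* C x R, through the global coordinates (x, y, t), where z = x + iy. *)
Definition heis := 'rV[R]_3.
Implicit Types (p q u v : heis).

Definition heis_mk (z : R[i]) (t : R) : heis :=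
  \row_(i < 3) [:: complex.Re z; complex.Im z; t]`_i.

(* On tangent vectors these are also the coordinate differentials dx, dy, dt. *)
Definition xc p : R := p ord0 (@Ordinal 3 0 isT).
Definition yc p : R := p ord0 (@Ordinal 3 1 isT).
Definition tc p : R := p ord0 (@Ordinal 3 2 isT).
Definition zc p : R[i] := (xc p +i* yc p)%C.

Definition heis_mul p q : heis :=
  heis_mk (zc p + zc q)
          (tc p + tc q + 2 * complex.Im (zc p * (zc q)^*%C)).

Definition d_x : heis := delta_mx ord0 (@Ordinal 3 0 isT).
Definition d_y : heis := delta_mx ord0 (@Ordinal 3 1 isT).
Definition d_t : heis := delta_mx ord0 (@Ordinal 3 2 isT).

Definition heisX p : heis := d_x + (2 * yc p) *: d_t.
Definition heisY p : heis := d_y - (2 * xc p) *: d_t.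
Definition heisT p : heis := d_t.
Definition heisT2 p : heis := 2 *: heisT p.

Definition heis_omega p v : R := tc v + 2 * xc p * yc v - 2 * yc p * xc v.
Definition heis_omega2 p v : R := 2^-1 * heis_omega p v.

(* dx^2 + dy^2 + omega^2 / 4; see heis_g_orthonormal. *)
Definition heis_g p u v : R :=
  xc u * xc v + yc u * yc v + 4^-1 * (heis_omega p u * heis_omega p v).

(* X, Y, T2 is the frame dual to dx, dy, omega2; see heis_phi_frame. *)
Definition heis_phi p v : heis := xc v *: heisY p - yc v *: heisX p.

Lemma heis_ext p q : xc p = xc q -> yc p = yc q -> tc p = tc q -> p = q.
Proof.
move=> pqx pqy pqt; apply/rowP => -[[|[|[|//]]] i].
all: by rewrite (bool_irrelevance i isT).
Qed.

Lemma heis_frame_coord p :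
  [/\ (xc (heisX p), yc (heisX p), tc (heisX p)) = (1, 0, 2 * yc p),
      (xc (heisY p), yc (heisY p), tc (heisY p)) = (0, 1, - (2 * xc p))
    & (xc (heisT2 p), yc (heisT2 p), tc (heisT2 p)) = (0, 0, 2)].
Proof.
by split; rewrite /heisX /heisY /heisT2 /heisT /d_x /d_y /d_t
  /xc /yc /tc !mxE /= ?(mulr0, mulr1, addr0, add0r, subr0, sub0r, oppr0).
Qed.

Lemma heis_mul_linear p q v (h : R) :
  heis_mul p (h *: v + q) - heis_mul p q =
  h *: (v + (2 * (yc p * xc v - xc p * yc v)) *: d_t).
Proof.
apply: heis_ext; rewrite /xc /yc /tc !mxE /= /xc /yc /tc !mxE /=; ring.
Qed.

Lemma derive_heis_mul p q v :
  'D_v (heis_mul p) q = v + (2 * (yc p * xc v - xc p * yc v)) *: d_t.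
Proof.
apply: cvg_lim => //; apply: (@cvg_near_cst _ _ _ _ _).
near=> h.
rewrite /= heis_mul_linear scalerA mulVf ?scale1r//.
by near: h; exact: nbhs_dnbhs_neq.
Unshelve. all: by end_near. Qed.

(* X, Y, T are left-invariant: the differential at q of the translation by p
   sends their value at q to their value at p * q. *)
Lemma heis_left_invariant p q :
  [/\ 'D_(heisX q) (heis_mul p) q = heisX (heis_mul p q),
      'D_(heisY q) (heis_mul p) q = heisY (heis_mul p q)
    & 'D_(heisT q) (heis_mul p) q = heisT (heis_mul p q)].
Proof.
rewrite !derive_heis_mul.
split; apply: heis_ext; rewrite /heisX /heisY /heisT /xc /yc /tc !mxE /=.
all: by rewrite /xc /yc ?mxE /=; ring.
Qed.

Lemma heis_phi_frame p :
  [/\ heis_phi p (heisX p) = heisY p, heis_phi p (heisY p) = - heisX p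
    & heis_phi p (heisT2 p) = 0].
Proof.
have [[Xx Xy _] [Yx Yy _] [Tx Ty _]] := heis_frame_coord p.
by split; rewrite /heis_phi ?(Xx, Xy, Yx, Yy, Tx, Ty);
  rewrite ?(scale1r, scale0r, subr0, sub0r, oppr0).
Qed.

Lemma heis_g_orthonormal p :
  let g := heis_g p in
  [/\ g (heisX p) (heisX p) = 1, g (heisY p) (heisY p) = 1
    & g (heisT2 p) (heisT2 p) = 1] /\
  [/\ g (heisX p) (heisY p) = 0, g (heisX p) (heisT2 p) = 0
    & g (heisY p) (heisT2 p) = 0].
Proof.
have [[Xx Xy Xt] [Yx Yy Yt] [Tx Ty Tt]] := heis_frame_coord p.
by split; split; rewrite /heis_g /heis_omega ?Xx ?Xy ?Xt ?Yx ?Yy ?Yt ?Tx ?Ty ?Tt;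
  field.
Qed.

End Heisenberg.

(* Main.v *)
Require Import Defs.
From mathcomp Require Import all_boot all_order all_algebra.
From mathcomp Require Import all_classical all_reals all_analysis.
From mathcomp Require Import all_fingroup ring lra.

Set Implicit Arguments.
Unset Strict Implicit.
Unset Printing Implicit Defensive.

Import Order.TTheory GRing.Theory Num.Theory.
Import numFieldNormedType.Exports.

Local Open Scope ring_scope.

(** The contact Riemannian axioms are identities between polynomials in the
    coordinates, because the exterior derivative of omega / 2 is the constant
    form 2 dx /\ dy.  The Reeb field is the constant field 2 d_t, and neither
    omega nor phi nor g depends on t, so that it is Killing.

    For the curvature identity the Levi-Civita connection is needed.  Write
    eta = omega / 2 and xi = 2 d_t.  Koszul's formula in the orthonormal frame
    X, Y, xi, whose only non-trivial bracket is [X, Y] = -2 xi, gives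
    nabla_X Y = - nabla_Y X = - xi, nabla_X xi = nabla_xi X = Y and
    nabla_Y xi = nabla_xi Y = - X.  In terms of the flat derivative D of the
    coordinates this says
      nabla_U W = D_U W + eta(W) phi(U) + eta(U) phi(W).
    The correction term is bilinear and symmetric, so that nabla is a
    torsion-free connection; [heis_gamma_metric] is the identity that makes it
    compatible with g.

    In R(U, xi) W every second derivative cancels, since D_U and D_xi commute
    up to the derivative of U along xi ([derive_derive_field], which rests on
    the symmetry [derive_comm] of second derivatives), and so do the first
    derivatives of U and W, since the correction term is constant along xi
    ([derive_heis_gammaT]).  The derivative of phi along U leaves a multiple
    of xi, and what remains is the pointwise identity
    [heis_gamma_curvature]. *)

(** * Calculus of smooth functions *)

Section SmoothFunctions.
Context {R : realType} {n : nat}.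
Notation V := 'rV[R]_n.

Lemma smooth_differentiable (T : normedModType R) (f : V -> T) p :
  smooth f -> differentiable f p.
Proof. by move=> /(_ [::]). Qed.

Lemma smooth_derivable (T : normedModType R) (f : V -> T) p v :
  smooth f -> derivable f p v.
Proof. by move=> sf; apply/diff_derivable/smooth_differentiable. Qed.

Lemma smooth_derive (T : normedModType R) (f : V -> T) v :
  smooth f -> smooth ('D_v f).
Proof. by move=> sf s p; have := sf (rcons s v) p; rewrite foldr_rcons. Qed.

(** Spares a formula for the iterated derivatives: it is enough to exhibit a
    class of differentiable functions stable under directional derivatives. *)
Lemma smooth_coind (T : normedModType R) (P : (V -> T) -> Prop) :
  (forall f p, P f -> differentiable f p) ->
  (forall f v, P f -> P ('D_v f)) ->
  forall f, P f -> smooth f.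
Proof.
move=> Pd PD f + s; elim/last_ind: s f => [|s v IHs] f Pf p; first exact: Pd.
by rewrite foldr_rcons; apply/IHs/PD.
Qed.

Lemma smooth_cst (T : normedModType R) (c : T) : smooth (fun _ : V => c).
Proof.
pose P (f : V -> T) := exists c, f = cst c.
apply: (@smooth_coind _ P) => [f p [d ->]|f v [d ->]|]; last by exists c.
- exact: differentiable_cst.
- by exists 0; apply/funext => q; rewrite derive_cst.
Qed.

(** Leibniz's rule turns one product into a sum of two, so that products of two
    smooth functions are not closed under derivatives; the subring that the
    smooth functions generate is, which gives sums and products at once. *)
Inductive sum_prod_smooth : (V -> R) -> Prop :=
| sum_prod_base f : smooth f -> sum_prod_smooth f
| sum_prod_add f g :
    sum_prod_smooth f -> sum_prod_smooth g -> sum_prod_smooth (f + g)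
| sum_prod_mul f g :
    sum_prod_smooth f -> sum_prod_smooth g -> sum_prod_smooth (f * g).

Lemma sum_prod_differentiable (f : V -> R) p :
  sum_prod_smooth f -> differentiable f p.
Proof.
elim=> {f} [f /smooth_differentiable//|f g _ df _ dg|f g _ df _ dg].
- exact: differentiableD.
- exact: differentiableM.
Qed.

Lemma sum_prod_smoothE (f : V -> R) : sum_prod_smooth f -> smooth f.
Proof.
apply: smooth_coind => {f} [f p|f v]; first exact: sum_prod_differentiable.
elim=> {f} [f sf|f g sf sDf sg sDg|f g sf sDf sg sDg].
- exact/sum_prod_base/smooth_derive.
- suff -> : 'D_v (f + g) = 'D_v f + 'D_v g by exact: sum_prod_add.
  apply/funext => p.
  by rewrite deriveD//; apply/diff_derivable/sum_prod_differentiable.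
- suff -> : 'D_v (f * g) = f * 'D_v g + g * 'D_v f.
    by apply: sum_prod_add; exact: sum_prod_mul.
  apply/funext => p.
  by rewrite deriveM//; apply/diff_derivable/sum_prod_differentiable.
Qed.

Lemma smoothD (f g : V -> R) :
  smooth f -> smooth g -> smooth (fun p => f p + g p).
Proof. by move=> sf sg; apply/sum_prod_smoothE/sum_prod_add; apply: sum_prod_base. Qed.

Lemma smoothM (f g : V -> R) :
  smooth f -> smooth g -> smooth (fun p => f p * g p).
Proof. by move=> sf sg; apply/sum_prod_smoothE/sum_prod_mul; apply: sum_prod_base. Qed.

Lemma smoothN (f : V -> R) : smooth f -> smooth (fun p => - f p).
Proof.
move=> sf; under eq_fun do rewrite -mulN1r.
exact/smoothM/sf/smooth_cst.
Qed.

Lemma smoothB (f g : V -> R) :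
  smooth f -> smooth g -> smooth (fun p => f p - g p).
Proof. by move=> sf sg; apply/smoothD/smoothN. Qed.

Lemma smooth_sum k (f : 'I_k -> V -> R) :
  (forall i, smooth (f i)) -> smooth (fun p => \sum_i f i p).
Proof.
move=> sf; elim: k => [|k IHk] in f sf *.
- by under eq_fun do rewrite big_ord0; exact: smooth_cst.
- by under eq_fun do rewrite big_ord_recr; exact: smoothD (IHk _ _) (sf _).
Qed.

Section Coordinates.
Context {k : nat}.
Implicit Types (W : V -> 'rV[R]_k) (i : 'I_1) (j : 'I_k).

Lemma derive_coord W p v i j : derivable W p v ->
  'D_v W p i j = 'D_v (fun q => W q i j) p.
Proof. by move=> dW; rewrite derive_mx// mxE. Qed.

Lemma differentiable_row W p :
  (forall i j, differentiable (fun q => W q i j) p) -> differentiable W p.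
Proof.
move=> dW.
have -> : W = \sum_j (fun q => W q ord0 j *: delta_mx ord0 j).
  by apply/funext => q; rewrite fct_sumE; exact: row_sum_delta.
by apply: differentiable_sum => j; exact: differentiableZl.
Qed.

Lemma smooth_rowP W : smooth W <-> forall i j, smooth (fun p => W p i j).
Proof.
split=> [sW i j|sW].
- pose P (f : V -> R) := exists2 U : V -> 'rV[R]_k, smooth U & f = fun p => U p i j.
  apply: (@smooth_coind _ P) => [f p [U sU ->]|f v [U sU ->]|]; last by exists W.
  + apply: (@differentiable_comp _ _ _ _ U (fun N : 'rV[R]_k => N i j)).
    * exact: smooth_differentiable.
    * exact: differentiable_coord.
  + exists ('D_v U); first exact: smooth_derive.
    by apply/funext => p; rewrite derive_coord//; exact: smooth_derivable.
- pose P (U : V -> 'rV[R]_k) := forall i j, smooth (fun p => U p i j).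
  apply: (@smooth_coind _ P) => // [U p sU|U v sU i j].
  + by apply: differentiable_row => i j; exact: smooth_differentiable.
  + suff -> : (fun p => 'D_v U p i j) = 'D_v (fun p => U p i j).
      exact: smooth_derive.
    apply/funext => p; rewrite derive_coord//; apply/diff_derivable.
    by apply: differentiable_row => ? ?; exact: smooth_differentiable.
Qed.

Lemma smooth_rowD W W' :
  smooth W -> smooth W' -> smooth (fun p => W p + W' p).
Proof.
move=> /smooth_rowP sW /smooth_rowP sW'; apply/smooth_rowP => i j.
by under eq_fun do rewrite mxE; exact: smoothD.
Qed.

Lemma smooth_rowZ (f : V -> R) W :
  smooth f -> smooth W -> smooth (fun p => f p *: W p).
Proof.
move=> sf /smooth_rowP sW; apply/smooth_rowP => i j.
by under eq_fun do rewrite mxE; exact: smoothM.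
Qed.

Lemma smooth_rowB W W' :
  smooth W -> smooth W' -> smooth (fun p => W p - W' p).
Proof.
move=> sW sW'; apply: smooth_rowD => //.
under eq_fun do rewrite -scaleN1r.
exact/smooth_rowZ/sW'/smooth_cst.
Qed.

End Coordinates.

Lemma smooth_id : smooth (id : V -> V).
Proof.
move=> s p; case/lastP: s => [|s v]; first exact: ex_diff.
rewrite foldr_rcons; apply: (_ : smooth ('D_v id)).
suff -> : 'D_v (id : V -> V) = fun=> v by exact: smooth_cst.
by apply/funext => q; rewrite derive_id.
Qed.

(** Smoothness makes the derivative linear in the direction; expanding a
    varying direction in the standard basis reduces derivatives along a vector
    field to derivatives in constant directions. *)
Lemma derive_fieldE (T : normedModType R) (f : V -> T) p v :
  smooth f -> 'D_v f p = \sum_j v ord0 j *: 'D_(delta_mx ord0 j) f p.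
Proof.
move=> sf; rewrite deriveE; last exact: smooth_differentiable.
rewrite {1}[v]row_sum_delta linear_sum; apply: eq_bigr => j _.
by rewrite linearZ -deriveE//; exact: smooth_differentiable.
Qed.

Lemma smooth_derive_field (U : V -> V) k (W : V -> 'rV[R]_k) :
  smooth U -> smooth W -> smooth (fun p => 'D_(U p) W p).
Proof.
move=> sU sW; apply/smooth_rowP => i j.
under eq_fun do rewrite derive_fieldE// summxE.
apply: smooth_sum => l; under eq_fun do rewrite mxE.
apply: smoothM; first exact: (smooth_rowP U).1.
exact: (smooth_rowP _).1 (smooth_derive _ sW) i j.
Qed.

Lemma deriveDv (T : normedModType R) (f : V -> T) p u v :
  smooth f -> 'D_(u + v) f p = 'D_u f p + 'D_v f p.
Proof.
by move=> sf; rewrite !deriveE ?linearD//; exact: smooth_differentiable.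
Qed.

Lemma deriveZv (T : normedModType R) (f : V -> T) p (a : R) v :
  smooth f -> 'D_(a *: v) f p = a *: 'D_v f p.
Proof.
by move=> sf; rewrite !deriveE ?linearZ//; exact: smooth_differentiable.
Qed.

End SmoothFunctions.

(** * Symmetry of second derivatives *)

Section Schwarz.
Context {R : realType} {n : nat}.
Notation V := 'rV[R]_n.

Lemma is_derive_line (f : V -> R) p u (s : R) : smooth f ->
  is_derive s 1 (fun t => f (p + t *: u)) ('D_u f (p + s *: u)).
Proof.
move=> sf.
have E : (fun h : R => h^-1 *: (((fun t => f (p + t *: u)) \o shift s) (h *: 1)
            - f (p + s *: u)))
       = (fun h => h^-1 *: ((f \o shift (p + s *: u)) (h *: u) - f (p + s *: u))).
  apply/funext => h /=; congr (_ *: (f _ - _)).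
  by rewrite [h *: 1]mulr1 scalerDl addrCA.
by split; rewrite /derivable /derive E//; exact: smooth_derivable.
Qed.

Lemma mean_value_from0 (F dF : R -> R) (h : R) :
  (forall t : R, is_derive t (1 : R) F (dF t)) -> 0 < h ->
  exists2 c, 0 < c < h & F h - F 0 = h * dF c.
Proof.
move=> FdF h0; have [|c] := MVT h0 (fun t _ => FdF t).
- apply/continuous_subspaceT => t.
  by apply/differentiable_continuous/derivable1_diffP; have [] := FdF t.
- by rewrite in_itv /= subr0 => ch ->; exists c => //; rewrite mulrC.
Qed.

(** The left-hand side is the increment over [0, h], in the direction v, of
    the increment of f over [0, h] in the direction u; each increment is a
    derivative at an intermediate point by the mean value theorem. *)
Lemma second_difference_mean_value (f : V -> R) p u v (h : R) :
  smooth f -> 0 < h ->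
  exists c d, [/\ 0 < c < h, 0 < d < h
    & (f (p + h *: v + h *: u) - f (p + h *: u)) - (f (p + h *: v) - f p)
      = h * (h * 'D_v ('D_u f) (p + c *: u + d *: v))].
Proof.
move=> sf h0.
have dF (t : R) : is_derive t (1 : R)
    (fun t => f (p + h *: v + t *: u) - f (p + t *: u))
    ('D_u f (p + h *: v + t *: u) - 'D_u f (p + t *: u)).
  exact: is_deriveB (is_derive_line _ _ _ sf) (is_derive_line _ _ _ sf).
have [c ch Ec] := mean_value_from0 dF h0.
have dG (t : R) := is_derive_line (p + c *: u) v t (smooth_derive u sf).
have [d dh Ed] := mean_value_from0 dG h0.
exists c, d; split => //.
by rewrite -Ed scale0r addr0 [p + c *: u + _]addrAC -Ec !scale0r !addr0.
Qed.

(** The second difference of f is symmetric in u and v, hence both mixed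
    derivatives, taken at suitable points of a small ball about p, agree;
    continuity at p concludes. *)
Lemma derive_comm (f : V -> R) p u v :
  smooth f -> 'D_u ('D_v f) p = 'D_v ('D_u f) p.
Proof.
move=> sf; apply/eqP; rewrite -subr_eq0 -normr_le0.
apply/ler_addgt0Pl => e e0; rewrite addr0.
have e2 : 0 < e / 2 by rewrite divr_gt0.
have near_p a b : \forall q \near p,
    `|'D_a ('D_b f) p - 'D_a ('D_b f) q| < e / 2.
  have := smooth_differentiable p (smooth_derive a (smooth_derive b sf)).
  by move/differentiable_continuous/cvgrPdist_lt; apply.
have : \forall q \near p,
    `|'D_u ('D_v f) p - 'D_u ('D_v f) q| < e / 2 /\
    `|'D_v ('D_u f) p - 'D_v ('D_u f) q| < e / 2.
  by move: (near_p u v) (near_p v u); apply: filterS2.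
move=> /nbhs_ballP [r /= r0 rP].
(* This h keeps p + c u + d v in the ball of radius r when 0 < c, d < h; the 1
   avoids a division by zero when u = v = 0. *)
pose h := r / (1 + `|u| + `|v|).
have N0 : 0 < 1 + `|u| + `|v| by rewrite -addrA ltr_pwDl// addr_ge0.
have h0 : 0 < h by rewrite divr_gt0.
have in_ball a b c d : 0 < c < h -> 0 < d < h -> `|a| + `|b| <= `|u| + `|v| ->
    ball p r (p + c *: a + d *: b).
  move=> /andP[c0 ch] /andP[d0 dh] ab.
  rewrite -ball_normE /ball_ /= -addrA opprD addNKr normrN.
  apply: (le_lt_trans (ler_normD _ _)); rewrite !normrZ !gtr0_norm//.
  have -> : r = h * (1 + `|u| + `|v|) by rewrite /h divfK ?gt_eqF.
  apply: (@le_lt_trans _ _ (h * (`|a| + `|b|))).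
    by rewrite mulrDr lerD// ler_wpM2r// ltW.
  rewrite ltr_pM2l// (le_lt_trans ab)// -addrA ltrDr//.
have [c [d [ch dh E]]] := second_difference_mean_value p v u sf h0.
have [c' [d' [ch' dh' E']]] := second_difference_mean_value p u v sf h0.
have /rP [/= Buv _] : ball p r (p + c *: v + d *: u).
  by apply: in_ball => //; rewrite addrC.
have /rP [/= _ Bvu] : ball p r (p + c' *: u + d' *: v) by exact: in_ball.
have Dq : 'D_u ('D_v f) (p + c *: v + d *: u)
        = 'D_v ('D_u f) (p + c' *: u + d' *: v).
  apply/(mulfI (negbT (gt_eqF h0)))/(mulfI (negbT (gt_eqF h0))).
  apply: etrans (esym E) (etrans _ E').
  by rewrite (addrAC p) !opprB addrACA [RHS]addrACA; congr (_ + _); rewrite addrC.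
rewrite Dq in Buv; apply: ltW; rewrite (splitr e).
apply: (le_lt_trans (ler_distD ('D_v ('D_u f) (p + c' *: u + d' *: v)) _ _)).
by apply: ltrD; [exact: Buv | rewrite distrC; exact: Bvu].
Qed.

End Schwarz.

(** * Derivatives of vector fields *)

Section Fields.
Context {R : realType} {n : nat}.
Notation V := 'rV[R]_n.

Lemma is_deriveE (T : normedModType R) (f : V -> T) p v df :
  is_derive p v f df -> 'D_v f p = df.
Proof. by case. Qed.

Lemma smooth_is_derive (T : normedModType R) (f : V -> T) p v :
  smooth f -> is_derive p v f ('D_v f p).
Proof. by move=> sf; split => //; exact: smooth_derivable. Qed.

Lemma smooth_is_derive_coord k (W : V -> 'rV[R]_k) p v i j :
  smooth W -> is_derive p v (fun q => W q i j) ('D_v W p i j).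
Proof.
move=> sW; rewrite derive_coord; last exact: smooth_derivable.
exact/smooth_is_derive/(smooth_rowP W).1.
Qed.

Lemma is_derive_row k (W : V -> 'rV[R]_k) p v (w : 'rV[R]_k) :
  (forall i j, is_derive p v (fun q => W q i j) (w i j)) -> is_derive p v W w.
Proof.
move=> dW; have dWp : derivable W p v by apply/derivable_mxP => i j.
split => //; apply/matrixP => i j.
by rewrite derive_coord//; exact: derive_val.
Qed.

Lemma is_derive_scale k (f : V -> R) (W : V -> 'rV[R]_k) p v df :
  is_derive p v f df -> smooth W ->
  is_derive p v (fun q => f q *: W q) (df *: W p + f p *: 'D_v W p).
Proof.
move=> fdf sW; apply: is_derive_row => i j; rewrite !mxE.
under eq_fun do rewrite mxE.
have dW := smooth_is_derive_coord p v i j sW.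
apply: is_derive_eq (is_deriveM fdf dW) _.
by rewrite addrC [_ *: df]mulrC.
Qed.

(** Chain rule for a direction that varies: expand it in the standard basis,
    apply Leibniz's rule, and exchange the two constant directions. *)
Lemma derive_derive_field k (W : V -> 'rV[R]_k) (U : V -> V) p v :
  smooth U -> smooth W ->
  'D_v (fun q => 'D_(U q) W q) p = 'D_('D_v U p) W p + 'D_(U p) ('D_v W) p.
Proof.
move=> sU sW; apply/rowP => l.
rewrite derive_coord; last exact/smooth_derivable/smooth_derive_field.
have sWl : smooth (fun q => W q ord0 l) by exact: (smooth_rowP W).1.
have coordD u q : 'D_u W q ord0 l = 'D_u (fun q => W q ord0 l) q.
  by rewrite derive_coord//; exact: smooth_derivable.
have -> : (fun q => 'D_(U q) W q ord0 l)
        = \sum_j (fun q => U q ord0 j)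
                 * ('D_(delta_mx ord0 j) (fun q => W q ord0 l)).
  by apply/funext => q; rewrite fct_sumE coordD derive_fieldE.
have dU j := smooth_is_derive_coord p v ord0 j sU.
have dW j := smooth_is_derive p v (smooth_derive (delta_mx ord0 j) sWl).
rewrite derive_sum; last by move=> j; have := is_deriveM (dU j) (dW j); case.
have sDW : smooth ('D_v W) by exact: smooth_derive.
rewrite mxE coordD derive_coord; last exact: smooth_derivable.
have -> : (fun q => 'D_v W q ord0 l) = 'D_v (fun q => W q ord0 l).
  by apply/funext => q; rewrite coordD.
rewrite (derive_fieldE p ('D_v U p) sWl).
rewrite (derive_fieldE p (U p) (smooth_derive v sWl)).
rewrite -big_split; apply: eq_bigr => j _ /=.
rewrite (is_deriveE (is_deriveM (dU j) (dW j))) [RHS]addrC.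
rewrite (derive_comm p v (delta_mx ord0 j) sWl).
move: ('D_v U p ord0 j) ('D_(delta_mx ord0 j) (fun q => W q ord0 l) p) => a b.
by rewrite [b *: a]mulrC.
Qed.

End Fields.

(** * Wedge products in dimension three *)

Section Wedge.
Context {R : realType} {n : nat}.
Notation V := 'rV[R]_n.

(** The permutation sum counts each of the two terms twice, which the factor
    1 / 2! compensates; both halves are instances of [wedge11]. *)
Lemma wedge_pow1_decomposable (a b : V -> R) (v : 'I_2 -> V) :
  wedge_pow (form2 (fun u w => a u * b w - a w * b u)) 1 v
  = a (v ord0) * b (v ord_max) - a (v ord_max) * b (v ord0).
Proof.
have E c d : \sum_(s : 'S_2) (-1) ^+ s * (c (v (s ord0)) * d (v (s ord_max)))
           = c (v ord0) * d (v ord_max) - c (v ord_max) * d (v ord0) :> R.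
  rewrite -(wedge11 c d v) /wedge /form1 -[1`!]/1%N mulr1 invr1 mul1r.
  apply: eq_bigr => s _; rewrite -mulrA.
  by congr (_ * (c (v (s _)) * d (v (s _)))); apply: val_inj.
rewrite /wedge_pow /wedge /form2.
under eq_bigr => s _.
  rewrite mulr1 (_ : lshift 0 ord0 = ord0); last exact: val_inj.
  rewrite (_ : lshift 0 ord_max = ord_max); last exact: val_inj.
  rewrite [a (v (s ord_max)) * _]mulrC mulrBr; over.
rewrite sumrB !E -[2`!]/2%N -[0`!]/1%N mulr1.
by field.
Qed.

(** For decomposable b /\ c, the permutation sum is a difference of two Leibniz
    expansions of determinants, so that nonvanishing of the volume form becomes
    a determinant computation. *)
Lemma wedge_form1_pow1_det (a b c : V -> R) (v : 'I_3 -> V) :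
  let det x y z := \det (\matrix_(i < 3, j < 3) [:: x (v j); y (v j); z (v j)]`_i) in
  wedge (form1 a) (wedge_pow (form2 (fun u w => b u * c w - b w * c u)) 1) v
  = 2^-1 * (det a b c - det a c b).
Proof.
move=> det; rewrite /wedge -[1`!]/1%N -[(1.*2)`!]/2%N mul1r; congr (_ * _).
rewrite /det -sumrB; apply: eq_bigr => s _.
rewrite wedge_pow1_decomposable /form1 -mulrA -mulrBr; congr (_ * _).
rewrite !big_ord_recl !big_ord0 !mxE /= !mulr1 -mulrBr.
by rewrite [c _ * b _]mulrC; congr (a (v (s _)) * (b (v (s _)) * c (v (s _))
  - b (v (s _)) * c (v (s _)))); apply: val_inj.
Qed.

End Wedge.

(** * The Heisenberg group: coordinates and the contact metric structure *)

Section Heisenberg.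
Context {R : realType}.
Local Notation V := 'rV[R]_3.
Implicit Types (p q u v w : V) (U W Z : V -> V).

Lemma xcD u v : xc (u + v) = xc u + xc v. Proof. by rewrite /xc mxE. Qed.
Lemma ycD u v : yc (u + v) = yc u + yc v. Proof. by rewrite /yc mxE. Qed.
Lemma tcD u v : tc (u + v) = tc u + tc v. Proof. by rewrite /tc mxE. Qed.
Lemma xcZ (a : R) v : xc (a *: v) = a * xc v. Proof. by rewrite /xc mxE. Qed.
Lemma ycZ (a : R) v : yc (a *: v) = a * yc v. Proof. by rewrite /yc mxE. Qed.
Lemma tcZ (a : R) v : tc (a *: v) = a * tc v. Proof. by rewrite /tc mxE. Qed.
Lemma xcN v : xc (- v) = - xc v. Proof. by rewrite /xc mxE. Qed.
Lemma ycN v : yc (- v) = - yc v. Proof. by rewrite /yc mxE. Qed.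
Lemma tcN v : tc (- v) = - tc v. Proof. by rewrite /tc mxE. Qed.
Lemma xc0 : xc (0 : V) = 0. Proof. by rewrite /xc mxE. Qed.
Lemma yc0 : yc (0 : V) = 0. Proof. by rewrite /yc mxE. Qed.
Lemma tc0 : tc (0 : V) = 0. Proof. by rewrite /tc mxE. Qed.

Lemma xcT p : xc (heisT2 p) = 0. Proof. by have [_ _ []] := heis_frame_coord p. Qed.
Lemma ycT p : yc (heisT2 p) = 0. Proof. by have [_ _ []] := heis_frame_coord p. Qed.
Lemma tcT p : tc (heisT2 p) = 2. Proof. by have [_ _ []] := heis_frame_coord p. Qed.
Lemma xcX p : xc (heisX p) = 1. Proof. by have [[]] := heis_frame_coord p. Qed.
Lemma ycX p : yc (heisX p) = 0. Proof. by have [[]] := heis_frame_coord p. Qed.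
Lemma tcX p : tc (heisX p) = 2 * yc p. Proof. by have [[]] := heis_frame_coord p. Qed.
Lemma xcY p : xc (heisY p) = 0. Proof. by have [_ []] := heis_frame_coord p. Qed.
Lemma ycY p : yc (heisY p) = 1. Proof. by have [_ []] := heis_frame_coord p. Qed.
Lemma tcY p : tc (heisY p) = - (2 * xc p).
Proof. by have [_ []] := heis_frame_coord p. Qed.

Lemma xcphi p v : xc (heis_phi p v) = - yc v.
Proof. by rewrite /heis_phi !(xcD, ycD, tcD, xcZ, ycZ, tcZ, xcN, ycN, tcN,
  xcX, ycX, tcX, xcY, ycY, tcY); ring. Qed.
Lemma ycphi p v : yc (heis_phi p v) = xc v.
Proof. by rewrite /heis_phi !(xcD, ycD, tcD, xcZ, ycZ, tcZ, xcN, ycN, tcN,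
  xcX, ycX, tcX, xcY, ycY, tcY); ring. Qed.
Lemma tcphi p v : tc (heis_phi p v) = - 2 * (xc p * xc v + yc p * yc v).
Proof. by rewrite /heis_phi !(xcD, ycD, tcD, xcZ, ycZ, tcZ, xcN, ycN, tcN,
  xcX, ycX, tcX, xcY, ycY, tcY); ring. Qed.

Definition coordE := (xcD, ycD, tcD, xcZ, ycZ, tcZ, xcN, ycN, tcN, xc0, yc0, tc0,
  xcT, ycT, tcT, xcX, ycX, tcX, xcY, ycY, tcY, xcphi, ycphi, tcphi).

Lemma smooth_xc W : smooth W -> smooth (fun p => xc (W p)).
Proof. by move=> sW; exact: (smooth_rowP W).1. Qed.
Lemma smooth_yc W : smooth W -> smooth (fun p => yc (W p)).
Proof. by move=> sW; exact: (smooth_rowP W).1. Qed.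
Lemma smooth_tc W : smooth W -> smooth (fun p => tc (W p)).
Proof. by move=> sW; exact: (smooth_rowP W).1. Qed.

Lemma smooth_omega W : smooth W -> smooth (fun p => heis_omega p (W p)).
Proof.
move=> sW; have [sx sy] := (smooth_xc smooth_id, smooth_yc smooth_id).
apply: smoothB; first apply: smoothD.
- exact: smooth_tc.
- by apply: smoothM; [apply: smoothM => //; exact: smooth_cst|exact: smooth_yc].
- by apply: smoothM; [apply: smoothM => //; exact: smooth_cst|exact: smooth_xc].
Qed.

Lemma smooth_omega2 W : smooth W -> smooth (fun p => heis_omega2 p (W p)).
Proof. by move=> sW; apply: smoothM; [exact: smooth_cst|exact: smooth_omega]. Qed.

Lemma smooth_heisX : smooth (@heisX R).
Proof.
apply: smooth_rowD; first exact: smooth_cst.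
apply: smooth_rowZ; last exact: smooth_cst.
by apply: smoothM; [exact: smooth_cst|exact: smooth_yc smooth_id].
Qed.

Lemma smooth_heisY : smooth (@heisY R).
Proof.
apply: smooth_rowB; first exact: smooth_cst.
apply: smooth_rowZ; last exact: smooth_cst.
by apply: smoothM; [exact: smooth_cst|exact: smooth_xc smooth_id].
Qed.

Lemma smooth_heisT2 : smooth (@heisT2 R).
Proof. rewrite /heisT2 /heisT; exact: smooth_cst. Qed.

Lemma smooth_phi W : smooth W -> smooth (fun p => heis_phi p (W p)).
Proof.
move=> sW; apply: smooth_rowB; apply: smooth_rowZ.
- exact: smooth_xc.
- exact: smooth_heisY.
- exact: smooth_yc.
- exact: smooth_heisX.
Qed.

Lemma smooth_g U W :
  smooth U -> smooth W -> smooth (fun p => heis_g p (U p) (W p)).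
Proof.
move=> sU sW; apply: smoothD; first apply: smoothD.
- by apply: smoothM; exact: smooth_xc.
- by apply: smoothM; exact: smooth_yc.
- apply: smoothM; first exact: smooth_cst.
  by apply: smoothM; exact: smooth_omega.
Qed.

Lemma is_derive_xc W p v :
  smooth W -> is_derive p v (fun q => xc (W q)) (xc ('D_v W p)).
Proof. exact: smooth_is_derive_coord. Qed.
Lemma is_derive_yc W p v :
  smooth W -> is_derive p v (fun q => yc (W q)) (yc ('D_v W p)).
Proof. exact: smooth_is_derive_coord. Qed.
Lemma is_derive_tc W p v :
  smooth W -> is_derive p v (fun q => tc (W q)) (tc ('D_v W p)).
Proof. exact: smooth_is_derive_coord. Qed.

Lemma is_derive_xc_id p v : is_derive p v (fun q => xc q) (xc v).
Proof. by have := is_derive_xc p v smooth_id; rewrite derive_id. Qed.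

Lemma is_derive_yc_id p v : is_derive p v (fun q => yc q) (yc v).
Proof. by have := is_derive_yc p v smooth_id; rewrite derive_id. Qed.

(** The last term is the derivative of the coefficients of omega; it is half the
    exterior derivative of omega, evaluated at v and W p. *)
Lemma is_derive_omega W p v : smooth W ->
  is_derive p v (fun q => heis_omega q (W q))
    (heis_omega p ('D_v W p) + 2 * (xc v * yc (W p) - yc v * xc (W p))).
Proof.
move=> sW.
have [dx dy] := (is_derive_xc_id p v, is_derive_yc_id p v).
have [dWx dWy dWt] := And3 (is_derive_xc p v sW) (is_derive_yc p v sW)
  (is_derive_tc p v sW).
have dl := is_deriveM (is_deriveM (is_derive_cst (2 : R) p v) dx) dWy.
have dr := is_deriveM (is_deriveM (is_derive_cst (2 : R) p v) dy) dWx.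
apply: is_derive_eq (is_deriveB (is_deriveD dWt dl) dr) _.
rewrite /heis_omega /GRing.scale /= !fctE; ring.
Qed.

Lemma is_derive_omega2 W p v : smooth W ->
  is_derive p v (fun q => heis_omega2 q (W q))
    (heis_omega2 p ('D_v W p) + (xc v * yc (W p) - yc v * xc (W p))).
Proof.
move=> sW.
have dom := is_derive_omega p v sW.
apply: is_derive_eq (is_deriveM (is_derive_cst (2^-1 : R) p v) dom) _.
by rewrite /heis_omega2 /GRing.scale /=; field.
Qed.

Lemma is_derive_g U W p v : smooth U -> smooth W ->
  is_derive p v (fun q => heis_g q (U q) (W q))
    (xc ('D_v U p) * xc (W p) + xc (U p) * xc ('D_v W p)
     + (yc ('D_v U p) * yc (W p) + yc (U p) * yc ('D_v W p))
     + ((heis_omega2 p ('D_v U p) + (xc v * yc (U p) - yc v * xc (U p)))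
          * heis_omega2 p (W p)
        + heis_omega2 p (U p)
          * (heis_omega2 p ('D_v W p) + (xc v * yc (W p) - yc v * xc (W p))))).
Proof.
move=> sU sW.
have -> : (fun q => heis_g q (U q) (W q))
  = (fun q => xc (U q)) * (fun q => xc (W q))
    + (fun q => yc (U q)) * (fun q => yc (W q))
    + (fun q => heis_omega2 q (U q)) * (fun q => heis_omega2 q (W q)).
  by apply/funext => q; rewrite /heis_g /heis_omega2 !fctE; field.
have dx := is_deriveM (is_derive_xc p v sU) (is_derive_xc p v sW).
have dy := is_deriveM (is_derive_yc p v sU) (is_derive_yc p v sW).
have deta := is_deriveM (is_derive_omega2 p v sU) (is_derive_omega2 p v sW).
apply: is_derive_eq (is_deriveD (is_deriveD dx dy) deta) _.
by rewrite /GRing.scale /=; ring.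
Qed.

(** The derivative of the coefficients of phi is vertical, because only the d_t
    components of X and Y depend on the point. *)
Lemma derive_phi W p v : smooth W ->
  'D_v (fun q => heis_phi q (W q)) p = heis_phi p ('D_v W p)
     - (xc v * xc (W p) + yc v * yc (W p)) *: heisT2 p.
Proof.
move=> sW; have sF := smooth_phi sW.
have dx := is_derive_xc p v sW; have dy := is_derive_yc p v sW.
have [dx0 dy0] := (is_derive_xc_id p v, is_derive_yc_id p v).
apply: heis_ext.
- rewrite -(is_deriveE (is_derive_xc p v sF)) !coordE.
  under eq_fun do rewrite xcphi.
  by rewrite (is_deriveE (is_deriveN dy)); ring.
- rewrite -(is_deriveE (is_derive_yc p v sF)) !coordE.
  under eq_fun do rewrite ycphi.
  by rewrite derive_val; ring.
- rewrite -(is_deriveE (is_derive_tc p v sF)) !coordE.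
  under eq_fun do rewrite tcphi.
  have d := is_deriveM (is_derive_cst (- 2 : R) p v)
    (is_deriveD (is_deriveM dx0 dx) (is_deriveM dy0 dy)).
  by rewrite (is_deriveE d) /GRing.scale /= !fctE; ring.
Qed.

Lemma heis_omega2_ext_d p u v :
  ext_d heis_omega2 p u v = 2 * xc u * yc v - 2 * xc v * yc u.
Proof.
rewrite /ext_d.
have := is_derive_omega2 p u (smooth_cst v).
have := is_derive_omega2 p v (smooth_cst u).
rewrite !derive_cst => dv du.
rewrite (is_deriveE dv) (is_deriveE du).
by rewrite /heis_omega2 /heis_omega !coordE; ring.
Qed.

(** On the frame (xi, X, Y) the form eta /\ d eta takes the value 2: the two
    determinants below are 2 and -2. *)
Lemma omega2_contact : @contact_form R 1 heis_omega2.
Proof.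
split; first split=> [p a u v|v].
- by rewrite /heis_omega2 /heis_omega !coordE /=; ring.
- exact: smooth_omega2 (smooth_cst v).
move=> p; exists (fun i => [:: heisT2 p; heisX p; heisY p]`_i).
have -> : ext_d heis_omega2 p
        = (fun u w => (2 * xc u) * yc w - (2 * xc w) * yc u).
  by apply/funext => u; apply/funext => w; exact: heis_omega2_ext_d.
rewrite (wedge_form1_pow1_det _ (fun u => 2 * xc u)).
rewrite (_ : _ - _ = 4); first by rewrite mulf_neq0 ?invr_eq0 ?pnatr_eq0.
rewrite !(expand_det_row _ ord0) !big_ord_recl !big_ord0 /cofactor.
rewrite !(expand_det_row _ ord0) !big_ord_recl !big_ord0 /cofactor !det_mx11.
rewrite !mxE /= /heis_omega2 /heis_omega !coordE.
by field.
Qed.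

Lemma heisT2_reeb : @reeb_field R 1 heis_omega2 heisT2.
Proof.
split=> [|p|p v]; first exact: smooth_heisT2.
- by rewrite /heis_omega2 /heis_omega !coordE; field.
- by rewrite heis_omega2_ext_d !coordE; ring.
Qed.

Lemma phi_endo : @endomorphism_field R 3 heis_phi.
Proof.
split=> [p a u v|v].
- by apply: heis_ext; rewrite !coordE; ring.
- exact: smooth_phi (smooth_cst v).
Qed.

Lemma g_metric : @riemannian_metric R 3 heis_g.
Proof.
split=> [p u a v w|p u v|p u|u v].
- by rewrite /heis_g /heis_omega !coordE /=; ring.
- by rewrite /heis_g; ring.
- move=> u0; rewrite lt_neqAle; apply/andP; split; last first.
    by rewrite /heis_g -!expr2 !addr_ge0 ?sqr_ge0// mulr_ge0 ?sqr_ge0.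
  apply: contra_neq u0 => gu.
  have : [/\ xc u = 0, yc u = 0 & heis_omega p u = 0].
    by split; rewrite /heis_g in gu; nra.
  case=> xu yu; rewrite /heis_omega xu yu !mulr0 subr0 addr0 => tu.
  by apply: heis_ext; rewrite ?xu ?yu ?tu !coordE.
- exact: smooth_g (smooth_cst u) (smooth_cst v).
Qed.

Lemma heis_contact_riemannian :
  @contact_riemannian R 1 heis_omega2 heisT2 heis_phi heis_g.
Proof.
split.
- exact: omega2_contact.
- exact: heisT2_reeb.
- exact: phi_endo.
- exact: g_metric.
- by move=> U _ p; rewrite /heis_g /heis_omega2 /heis_omega !coordE; field.
- move=> U W _ _ p; rewrite heis_omega2_ext_d /heis_g /heis_omega !coordE.
  by field.
- move=> U _ p; apply: heis_ext;
  by rewrite /heis_omega2 /heis_omega !coordE; field.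
Qed.

Lemma lie_heisT2 U p : lie heisT2 U p = 'D_(heisT2 p) U p.
Proof. by rewrite /lie (_ : @heisT2 R = cst (2 *: d_t))// derive_cst subr0. Qed.

Lemma heisT2_killing : @killing R 3 heis_g heisT2.
Proof.
move=> U W sU sW p; rewrite /lie_metric !lie_heisT2.
rewrite (is_deriveE (is_derive_g p (heisT2 p) sU sW)).
move: ('D_(heisT2 p) U p) ('D_(heisT2 p) W p) (U p) (W p) => u' w' u w.
by rewrite /heis_g /heis_omega2 /heis_omega !coordE; field.
Qed.

(** * The Levi-Civita connection and its curvature *)

(** The Christoffel symbols of g in the coordinate frame, in invariant form. *)
Definition heis_gamma p u w : V :=
  heis_omega2 p w *: heis_phi p u + heis_omega2 p u *: heis_phi p w.

Definition heis_nabla U W : V -> V :=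
  fun p => 'D_(U p) W p + heis_gamma p (U p) (W p).

Lemma heis_gammaC p u w : heis_gamma p u w = heis_gamma p w u.
Proof. by rewrite /heis_gamma addrC. Qed.

Lemma heis_gammaDl p u v w :
  heis_gamma p (u + v) w = heis_gamma p u w + heis_gamma p v w.
Proof.
by apply: heis_ext; rewrite /heis_gamma /heis_omega2 /heis_omega !coordE; ring.
Qed.

Lemma heis_gammaZl p a u w : heis_gamma p (a *: u) w = a *: heis_gamma p u w.
Proof.
by apply: heis_ext; rewrite /heis_gamma /heis_omega2 /heis_omega !coordE; ring.
Qed.

Lemma heis_gammaDr p u v w :
  heis_gamma p u (v + w) = heis_gamma p u v + heis_gamma p u w.
Proof. by rewrite !(heis_gammaC p u) heis_gammaDl. Qed.

Lemma heis_gammaZr p a u w : heis_gamma p u (a *: w) = a *: heis_gamma p u w.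
Proof. by rewrite !(heis_gammaC p u) heis_gammaZl. Qed.

Lemma heis_gammaT p w : heis_gamma p (heisT2 p) w = heis_phi p w.
Proof.
by apply: heis_ext; rewrite /heis_gamma /heis_omega2 /heis_omega !coordE; field.
Qed.

(** Here w' and z' stand for the derivatives along u of fields with values w
    and z; the left-hand side is the expression of [is_derive_g]. *)
Lemma heis_gamma_metric p u w z w' z' :
  xc w' * xc z + xc w * xc z' + (yc w' * yc z + yc w * yc z')
  + ((heis_omega2 p w' + (xc u * yc w - yc u * xc w)) * heis_omega2 p z
     + heis_omega2 p w * (heis_omega2 p z' + (xc u * yc z - yc u * xc z)))
  = heis_g p (w' + heis_gamma p u w) z + heis_g p w (z' + heis_gamma p u z).
Proof.
by rewrite /heis_g /heis_gamma /heis_omega2 /heis_omega !coordE; field.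
Qed.

(** What survives in the curvature once all derivatives of the fields have
    cancelled.  The left-hand side reduces to eta(w) phi^2(u) + <u, w> xi, where
    <u, w> is the horizontal inner product and phi^2(u) = - u + eta(u) xi. *)
Lemma heis_gamma_curvature p u w :
  heis_phi p (heis_gamma p u w) + (xc u * xc w + yc u * yc w) *: heisT2 p
    - heis_gamma p u (heis_phi p w)
  = heis_g p u w *: heisT2 p - heis_g p (heisT2 p) w *: u.
Proof.
apply: heis_ext;
by rewrite /heis_g /heis_gamma /heis_omega2 /heis_omega !coordE; field.
Qed.

Lemma smooth_heis_gamma U W :
  smooth U -> smooth W -> smooth (fun p => heis_gamma p (U p) (W p)).
Proof.
move=> sU sW; apply: smooth_rowD.
- by apply: smooth_rowZ; [exact: smooth_omega2|exact: smooth_phi].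
- by apply: smooth_rowZ; [exact: smooth_omega2|exact: smooth_phi].
Qed.

Lemma heis_nabla_connection : affine_connection heis_nabla.
Proof.
split=> [U W sU sW|U W Z sU sW sZ p|f U W sf sU sW p|U W Z sU sW sZ p
        |f U W sf sU sW p]; rewrite /heis_nabla.
- exact: smooth_rowD (smooth_derive_field sU sW) (smooth_heis_gamma sU sW).
- by rewrite deriveDv// heis_gammaDl addrACA.
- by rewrite deriveZv// heis_gammaZl [RHS]scalerDr.
- have dW := smooth_is_derive p (U p) sW.
  have dZ := smooth_is_derive p (U p) sZ.
  by rewrite (is_deriveE (is_deriveD dW dZ)) heis_gammaDr addrACA.
- have df := smooth_is_derive p (U p) sf.
  rewrite (is_deriveE (is_derive_scale df sW)) heis_gammaZr.
  by rewrite [X in _ = _ + X]scalerDr addrA.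
Qed.

Lemma heis_nabla_levi_civita : levi_civita heis_g heis_nabla.
Proof.
split=> [|U W sU sW p|U W Z sU sW sZ p]; first exact: heis_nabla_connection.
- by rewrite /heis_nabla (heis_gammaC p (W p)) opprD addrACA subrr addr0.
- rewrite (is_deriveE (is_derive_g p (U p) sW sZ)).
  exact: heis_gamma_metric.
Qed.

(** The derivatives of the coefficients of eta and phi along xi vanish, since
    they only depend on x and y. *)
Lemma derive_heis_gammaT U W p : smooth U -> smooth W ->
  'D_(heisT2 p) (fun q => heis_gamma q (U q) (W q)) p
  = heis_gamma p ('D_(heisT2 p) U p) (W p)
    + heis_gamma p (U p) ('D_(heisT2 p) W p).
Proof.
move=> sU sW; set v := heisT2 p.
have dWU := is_derive_scale (is_derive_omega2 p v sW) (smooth_phi sU).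
have dUW := is_derive_scale (is_derive_omega2 p v sU) (smooth_phi sW).
apply: etrans (is_deriveE (is_deriveD dWU dUW)) _.
rewrite (derive_phi p v sU) (derive_phi p v sW) /v.
move: ('D_(heisT2 p) U p) ('D_(heisT2 p) W p) (U p) (W p) => u' w' u w.
by apply: heis_ext; rewrite /heis_gamma !coordE; ring.
Qed.

Lemma heis_nablaT W p :
  heis_nabla heisT2 W p = 'D_(heisT2 p) W p + heis_phi p (W p).
Proof. by rewrite /heis_nabla heis_gammaT. Qed.

(** The three terms of the curvature are computed separately as TT, UT and LT;
    the second derivatives and all derivatives of U and W cancel in their sum,
    and [heis_gamma_curvature] gives the rest. *)
Lemma heis_curvature U W p : smooth U -> smooth W ->
  curvature heis_nabla U heisT2 W p
  = heis_g p (U p) (W p) *: heisT2 p - heis_g p (heisT2 p) (W p) *: U p.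
Proof.
move=> sU sW; rewrite -heis_gamma_curvature /curvature.
pose t : V := 2 *: d_t.
have sDW : smooth ('D_t W) := smooth_derive t sW.
have TT : heis_nabla heisT2 (heis_nabla U W) p
    = 'D_('D_t U p) W p + 'D_(U p) ('D_t W) p
      + (heis_gamma p ('D_t U p) (W p) + heis_gamma p (U p) ('D_t W p))
      + heis_phi p (heis_nabla U W p).
  rewrite heis_nablaT; congr (_ + _).
  rewrite -(derive_derive_field p t sU sW) -(derive_heis_gammaT p sU sW).
  have dUW := smooth_is_derive p t (smooth_derive_field sU sW).
  have dG := smooth_is_derive p t (smooth_heis_gamma sU sW).
  exact: is_deriveE (is_deriveD dUW dG).
have UT : heis_nabla U (heis_nabla heisT2 W) p
    = 'D_(U p) ('D_t W) p + (heis_phi p ('D_(U p) W p)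
        - (xc (U p) * xc (W p) + yc (U p) * yc (W p)) *: heisT2 p)
      + heis_gamma p (U p) ('D_t W p + heis_phi p (W p)).
  have -> : heis_nabla heisT2 W = (fun q => 'D_t W q + heis_phi q (W q)).
    by apply/funext => q; exact: heis_nablaT.
  have dTW := smooth_is_derive p (U p) sDW.
  have dphi := smooth_is_derive p (U p) (smooth_phi sW).
  rewrite (derive_phi p (U p) sW) in dphi.
  by rewrite /heis_nabla (is_deriveE (is_deriveD dTW dphi)).
have LT : heis_nabla (lie U heisT2) W p
    = - 'D_('D_t U p) W p - heis_gamma p ('D_t U p) (W p).
  rewrite /heis_nabla.
  have -> : lie U heisT2 p = (-1) *: 'D_t U p.
    by rewrite /lie (_ : @heisT2 R = cst t)// derive_cst sub0r scaleN1r.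
  by rewrite deriveZv// heis_gammaZl !scaleN1r.
rewrite TT UT LT heis_gammaDr.
have -> : heis_phi p (heis_nabla U W p)
        = heis_phi p ('D_(U p) W p) + heis_phi p (heis_gamma p (U p) (W p)).
  by apply: heis_ext; rewrite !coordE; ring.
move: ('D_('D_t U p) W p) ('D_(U p) ('D_t W) p) (_ *: heisT2 p) => a b c.
move: (heis_gamma p ('D_t U p) _) (heis_gamma p _ ('D_t W p)) => d e.
move: (heis_phi p ('D_(U p) W p)) (heis_phi p (heis_gamma _ _ _)) => f h.
move: (heis_gamma p _ _) => k.
by apply: heis_ext; rewrite !coordE; ring.
Qed.

End Heisenberg.

Theorem proposition3p4 (R : realType) :
  @sasakian R 1 heis_omega2 heisT2 heis_phi heis_g.
Proof.
split.
- exact: heis_contact_riemannian.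
- exact: heisT2_killing.
- by move=> p; have [[_ _ ->]] := heis_g_orthonormal p.
- exists heis_nabla; first exact: heis_nabla_levi_civita.
  by move=> U W sU sW p; exact: heis_curvature.
Qed.
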